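(* If $\clubsuit$ holds then there is a family $\{S_\beta:\beta<\omega_2\}$ of stationary subsets of $\omega_1$ which is almost disjoint (i.e. $S_\beta\cap S_\gamma$ is countable for $\beta\neq\gamma$); hence $\mathrm{NS}_{\omega_1}$ is not saturated. Consequently, it is consistent that Galvin's property fails and $\mathrm{NS}_{\omega_1}$ is not saturated.
   Context: $\clubsuit$ (tiltan) at $\aleph_1$: there is a sequence $\langle T_\alpha:\alpha\in\lim(\omega_1)\rangle$ such that each $T_\alpha$ is a cofinal subset of $\alpha$, and for every unbounded $A\subseteq\omega_1$ the set $\{\alpha: T_\alpha\subseteq A\}$ is stationary. An ideal $\mathcal{I}$ over $\omega_1$ is saturated iff in every collection $\{S_\alpha:\alpha<\omega_2\}$ of $\mathcal{I}$-positive sets there are distinct $\alpha,\beta$ with $S_\alpha\cap S_\beta\notin\mathcal{I}$; $\mathrm{NS}_{\omega_1}$ is the nonstationary ideal on $\omega_1$. Galvin's property (at $\aleph_1$): every collection $\{C_\alpha:\alpha<\omega_2\}$ of club subsets of $\omega_1$ has a subcollection $\{C_{\alpha_\beta}:\beta<\omega_1\}$ (distinct indices) whose intersection is a club of $\omega_1$. *)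

(* Defs.v *)
From Stdlib Require Import Classical.

Set Implicit Arguments.

Section Ord.
Variables (O : Type) (lt : O -> O -> Prop).

Definition le (a b : O) : Prop := lt a b \/ a = b.

Definition is_wellorder : Prop :=
  (forall a, ~ lt a a) /\
  (forall a b c, lt a b -> lt b c -> lt a c) /\
  (forall a b, lt a b \/ a = b \/ lt b a) /\
  well_founded lt.

Definition countable (X : O -> Prop) : Prop :=
  exists f : O -> nat, forall a b, X a -> X b -> f a = f b -> a = b.

Definition is_limit (a : O) : Prop :=
  (exists b, lt b a) /\ (forall b, lt b a -> exists c, lt b c /\ lt c a).

Definition cofinal_in (T : O -> Prop) (a : O) : Prop :=
  (forall b, T b -> lt b a) /\ (forall b, lt b a -> exists c, T c /\ le b c).

Definition unbounded (A : O -> Prop) : Prop :=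
  forall b, exists c, A c /\ le b c.

Definition closed (C : O -> Prop) : Prop :=
  forall a, is_limit a ->
    (forall b, lt b a -> exists c, C c /\ lt b c /\ lt c a) -> C a.

Definition club (C : O -> Prop) : Prop := closed C /\ unbounded C.

Definition stationary (S : O -> Prop) : Prop :=
  forall C, club C -> exists a, C a /\ S a.

Definition clubsuit : Prop :=
  exists T : O -> O -> Prop,
    (forall a, is_limit a -> cofinal_in (T a) a) /\
    (forall A, unbounded A ->
       stationary (fun a => is_limit a /\ forall b, T a b -> A b)).

Definition is_omega1 : Prop :=
  is_wellorder /\
  (forall a, countable (fun b => lt b a)) /\
  ~ countable (fun _ => True).

End Ord.

Definition is_omega2_over (K O : Type) (ltK : K -> K -> Prop) : Prop :=
  is_wellorder ltK /\
  (forall k, exists f : K -> O,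
      forall x y, ltK x k -> ltK y k -> f x = f y -> x = y) /\
  ~ (exists f : K -> O, forall x y, f x = f y -> x = y).

Definition NS_saturated (O K : Type) (lt : O -> O -> Prop) : Prop :=
  forall S : K -> O -> Prop,
    (forall k, stationary lt (S k)) ->
    exists k1 k2, k1 <> k2 /\ stationary lt (fun a => S k1 a /\ S k2 a).

(* Main.v *)
(* Partition omega_1 into omega_1 disjoint uncountable pieces D_xi.  By recursion
   along omega_2 build unbounded sets A_k: using an injection e_k of the
   predecessors of k into omega_1, A_k takes from each piece D_xi one point above
   xi avoiding every earlier A_y with e_k(y) < xi.  Each A_y meets D_xi in at most
   one point and only countably many y are involved, so such a point exists, and
   A_k meets A_y only in points taken from the countably many pieces with
   xi <= e_k(y).  The clubsuit sequence turns A_k into the stationary set S_k of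
   limits alpha with T_alpha included in A_k; as T_alpha is cofinal in alpha,
   S_k and S_y meet below a bound of A_k /\ A_y, so their intersection is
   countable, hence nonstationary, which refutes saturation. *)
Require Import Defs.
From Stdlib Require Import Classical ClassicalEpsilon FunctionalExtensionality.
From Stdlib Require Import PropExtensionality Cantor.
Set Implicit Arguments.

Lemma choice_on (A B : Type) (Q : A -> Prop) (P : A -> B -> Prop) (b0 : B) :
  (forall a, Q a -> exists b, P a b) -> exists f : A -> B, forall a, Q a -> P a (f a).
Proof.
  intro H.
  destruct (@choice A B (fun a b => Q a -> P a b)) as [f Hf].
  - intro a. destruct (classic (Q a)) as [q | nq].
    + destruct (H a q) as [b Hb]. exists b; auto.
    + exists b0; intro; contradiction.
  - exists f; exact Hf.
Qed.

Section Countable.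
Variable A : Type.

Lemma countable_subset (X Y : A -> Prop) :
  countable X -> (forall a, Y a -> X a) -> countable Y.
Proof. intros [f Hf] HYX. exists f. auto. Qed.

Lemma countable_eq (x : A) : countable (fun a => a = x).
Proof. exists (fun _ => 0). intros; subst; auto. Qed.

Lemma countable_image (B : Type) (X : A -> Prop) (g : A -> B) :
  countable X -> countable (fun b => exists a, X a /\ b = g a).
Proof.
  intros [f Hf].
  destruct (choice_on (fun b => exists a, X a /\ b = g a)
     (fun b n => exists a, X a /\ b = g a /\ f a = n) 0) as [h Hh].
  { intros b [a [Xa ->]]. eauto. }
  exists h. intros b1 b2 i1 i2 E.
  destruct (Hh b1 i1) as [a1 [X1 [-> F1]]].
  destruct (Hh b2 i2) as [a2 [X2 [-> F2]]].
  f_equal. apply Hf; congruence.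
Qed.

Lemma countable_bigcup (I : Type) (Idx : I -> Prop) (B : I -> A -> Prop) :
  countable Idx -> (forall i, Idx i -> countable (B i)) ->
  countable (fun a => exists i, Idx i /\ B i a).
Proof.
  intros [fI HI] HB.
  destruct (choice_on Idx (fun i (g : A -> nat) =>
     forall a b, B i a -> B i b -> g a = g b -> a = b) (fun _ => 0) HB) as [g Hg].
  destruct (choice_on (fun a => exists i, Idx i /\ B i a)
     (fun a n => exists i, Idx i /\ B i a /\ n = to_nat (fI i, g i a)) 0) as [h Hh].
  { intros a [i [Ii Bia]]. eauto. }
  exists h. intros a1 a2 i1 i2 E.
  destruct (Hh a1 i1) as [j1 [I1 [B1 E1]]].
  destruct (Hh a2 i2) as [j2 [I2 [B2 E2]]].
  rewrite E1, E2 in E. apply (f_equal of_nat) in E. rewrite !cancel_of_to in E.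
  injection E as Ej Ea.
  assert (j1 = j2) as <- by auto.
  exact (Hg j1 I1 _ _ B1 B2 Ea).
Qed.

Lemma countable_union (X Y : A -> Prop) :
  countable X -> countable Y -> countable (fun a => X a \/ Y a).
Proof.
  intros HX HY.
  apply countable_subset
    with (X := fun a => exists i : bool, True /\ (if i then X a else Y a)).
  - apply countable_bigcup.
    + exists (fun b : bool => if b then 0 else 1). intros [] []; simpl; auto; discriminate.
    + intros []; auto.
  - intros a [H | H]; [exists true | exists false]; auto.
Qed.

End Countable.

Section Omega1.
Variables (O : Type) (lt : O -> O -> Prop).
Hypothesis Hw : is_omega1 lt.

Lemma lt_irrefl a : ~ lt a a.
Proof. apply Hw. Qed.

Lemma lt_trans a b c : lt a b -> lt b c -> lt a c.
Proof. apply Hw. Qed.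

Lemma lt_trichotomy a b : lt a b \/ a = b \/ lt b a.
Proof. apply Hw. Qed.

Lemma countable_lt a : countable (fun b => lt b a).
Proof. apply Hw. Qed.

Lemma uncountable_full : ~ countable (fun _ : O => True).
Proof. apply Hw. Qed.

Lemma omega1_inhabited : exists o : O, True.
Proof.
  apply NNPP; intro H. apply uncountable_full.
  exists (fun _ => 0). intros a. exfalso; eauto.
Qed.

Lemma countable_le b : countable (fun a => le lt a b).
Proof. apply countable_union; [apply countable_lt | apply countable_eq]. Qed.

Lemma not_lt_le a b : ~ lt b a -> le lt a b.
Proof. intro H. destruct (lt_trichotomy a b) as [? | [? | ?]]; [left | right | ]; tauto. Qed.

Lemma countable_bounded (X : O -> Prop) :
  countable X -> exists b, forall x, X x -> lt x b.
Proof.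
  intro HX. apply NNPP. intro H. apply uncountable_full.
  apply countable_subset with (X := fun a => exists x, X x /\ le lt a x).
  - apply countable_bigcup; auto. intros; apply countable_le.
  - intros a _. apply NNPP. intro H'. apply H. exists a. intros x Xx.
    apply NNPP; intro Hx. apply H'. exists x. split; auto. apply not_lt_le; auto.
Qed.

Lemma uncountable_unbounded (X : O -> Prop) : ~ countable X -> unbounded lt X.
Proof.
  intros HX b. apply NNPP. intro H. apply HX.
  apply countable_subset with (X := fun a => lt a b); [apply countable_lt |].
  intros a Xa. apply NNPP; intro Hab. apply H. exists a. split; auto.
  apply not_lt_le; auto.
Qed.

Lemma uncountable_gt d : ~ countable (lt d).
Proof.
  intro H. apply uncountable_full.
  apply countable_subset with (X := fun a => le lt a d \/ lt d a).
  - apply countable_union; auto. apply countable_le.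
  - intros a _. destruct (classic (lt d a)); auto. left; apply not_lt_le; auto.
Qed.

Lemma uncountable_fiber (X : O -> Prop) (h : O -> nat) :
  ~ countable X -> exists n, ~ countable (fun a => X a /\ h a = n).
Proof.
  intro HX. apply NNPP. intro H. apply HX.
  apply countable_subset with (X := fun a => exists n, True /\ (X a /\ h a = n)).
  - apply countable_bigcup; [exists (fun n => n); auto |].
    intros n _. apply NNPP; intro H'. apply H; eauto.
  - intros a Xa. exists (h a); auto.
Qed.

(* Ulam-matrix style: with g_a injecting the predecessors of a into nat, each d has
   a value n_d with uncountably many a > d satisfying g_a(d) = n_d, and one value N
   is taken by uncountably many d; the pieces for these d are then disjoint. *)
Lemma uncountable_disjoint_family : exists (Dl : O -> Prop) (D : O -> O -> Prop),
  ~ countable Dl /\ (forall d, Dl d -> ~ countable (D d)) /\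
  (forall d d' a, Dl d -> Dl d' -> D d a -> D d' a -> d = d').
Proof.
  destruct (@choice O (O -> nat)
     (fun a g => forall x y, lt x a -> lt y a -> g x = g y -> x = y)) as [g Hg].
  { intro a. apply countable_lt. }
  destruct (@choice O nat (fun d n => ~ countable (fun a => lt d a /\ g a d = n)))
    as [n Hn].
  { intro d. apply uncountable_fiber, uncountable_gt. }
  destruct (uncountable_fiber n uncountable_full) as [N HN].
  exists (fun d => True /\ n d = N), (fun d a => lt d a /\ g a d = n d).
  split; [exact HN |]. split.
  - intros d _. apply Hn.
  - intros d d' a [_ Hd] [_ Hd'] [Hda Ed] [Hd'a Ed']. apply (Hg a); congruence.
Qed.

End Omega1.

Lemma well_founded_relational_recursion (K X : Type) (R : K -> K -> Prop)
  (x0 : X) (Step : K -> (K -> X) -> X -> Prop) :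
  well_founded R ->
  (forall k A, exists x, Step k A x) ->
  (forall k A B, (forall y, R y k -> A y = B y) -> forall x, Step k A x -> Step k B x) ->
  exists A : K -> X, forall k, Step k A (A k).
Proof.
  intros wf Htot Hext.
  set (extend := fun k (rec : forall y, R y k -> X) (y : K) =>
         match excluded_middle_informative (R y k) with
         | left p => rec y p | right _ => x0 end).
  set (step := fun k (rec : forall y, R y k -> X) =>
         proj1_sig (constructive_indefinite_description _ (Htot k (extend k rec)))).
  exists (Fix wf (fun _ => X) step). intro k.
  rewrite (Fix_eq wf (fun _ => X) step).
  2:{ intros x f g Hfg. replace g with f; [reflexivity |].
      apply functional_extensionality_dep; intro y.
      apply functional_extensionality_dep; intro p. apply Hfg. }
  apply (Hext k (extend k (fun y _ => Fix wf (fun _ => X) step y))).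
  - intros y p. unfold extend. destruct (excluded_middle_informative (R y k)); tauto.
  - exact (proj2_sig (constructive_indefinite_description _ _)).
Qed.

Section AlmostDisjoint.
Variables (O : Type) (lt : O -> O -> Prop).
Hypothesis Hw : is_omega1 lt.
Variables (Dl : O -> Prop) (D : O -> O -> Prop).
Hypothesis Dl_uncountable : ~ countable Dl.
Hypothesis D_uncountable : forall d, Dl d -> ~ countable (D d).
Hypothesis D_disjoint : forall d d' a, Dl d -> Dl d' -> D d a -> D d' a -> d = d'.
Variables (K : Type) (ltK : K -> K -> Prop) (e : K -> K -> O).
Hypothesis e_inj : forall k x y, ltK x k -> ltK y k -> e k x = e k y -> x = y.

Definition admissible k (A : K -> O -> Prop) xi a : Prop :=
  D xi a /\ lt xi a /\ forall y, ltK y k -> lt (e k y) xi -> ~ A y a.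

Definition ad_step k (A : K -> O -> Prop) (Z : O -> Prop) : Prop :=
  exists p : O -> O,
    (forall xi, Dl xi -> (exists a, admissible k A xi a) -> admissible k A xi (p xi)) /\
    Z = (fun a => exists xi, Dl xi /\ admissible k A xi a /\ a = p xi).

Lemma admissible_ext k A B xi a :
  (forall y, ltK y k -> A y = B y) -> admissible k A xi a -> admissible k B xi a.
Proof.
  intros HAB [HD [Hlt Havoid]]. repeat split; auto.
  intros y Hy. rewrite <- HAB; auto.
Qed.

Lemma ad_step_total k A : exists Z, ad_step k A Z.
Proof.
  destruct (omega1_inhabited Hw) as [o0 _].
  destruct (choice_on (fun xi => Dl xi /\ exists a, admissible k A xi a)
     (fun xi a => admissible k A xi a) o0) as [p Hp].
  { intros xi [_ H]; exact H. }
  eexists. exists p. split; [intros xi H1 H2; apply Hp; auto | reflexivity].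
Qed.

Lemma ad_step_ext k A B :
  (forall y, ltK y k -> A y = B y) -> forall Z, ad_step k A Z -> ad_step k B Z.
Proof.
  intros HAB Z [p [Hp ->]].
  assert (HBA : forall y, ltK y k -> B y = A y) by (intros; symmetry; auto).
  exists p. split.
  - intros xi Hxi [a Ha]. apply admissible_ext with A; auto.
    apply Hp; auto. exists a. apply admissible_ext with B; auto.
  - apply functional_extensionality; intro a. apply propositional_extensionality.
    split; intros [xi [H1 [H2 H3]]]; exists xi; (split; [auto | split; [| auto]]);
      [apply admissible_ext with A | apply admissible_ext with B]; auto.
Qed.

Variables (A : K -> O -> Prop) (p : K -> O -> O).
Hypothesis p_admissible :
  forall k xi, Dl xi -> (exists a, admissible k A xi a) -> admissible k A xi (p k xi).
Hypothesis A_def :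
  forall k, A k = (fun a => exists xi, Dl xi /\ admissible k A xi a /\ a = p k xi).

Lemma A_meet_piece_countable y xi : Dl xi -> countable (fun a => A y a /\ D xi a).
Proof.
  intro Hxi. apply countable_subset with (X := fun a => a = p y xi);
    [apply countable_eq |].
  intros a [Ha HDa]. rewrite A_def in Ha. destruct Ha as [xi' [H1 [[HD _] ->]]].
  now rewrite (D_disjoint H1 Hxi HD HDa).
Qed.

(* D_xi is uncountable, while its points below xi or lying in one of the
   countably many relevant A_y form a countable set. *)
Lemma admissible_exists k xi : Dl xi -> exists a, admissible k A xi a.
Proof.
  intro Hxi. apply NNPP; intro H. apply (D_uncountable Hxi).
  apply countable_subset with (X := fun a => le lt a xi \/
      exists y, (ltK y k /\ lt (e k y) xi) /\ (A y a /\ D xi a)).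
  - apply countable_union; [apply countable_le; auto |]. apply countable_bigcup.
    + destruct (countable_lt Hw xi) as [f Hf]. exists (fun y => f (e k y)).
      intros y1 y2 [H1 L1] [H2 L2] E. apply (e_inj H1 H2); auto.
    + intros y _. apply A_meet_piece_countable; auto.
  - intros a HDa. destruct (classic (lt xi a)) as [Hlt | Hlt];
      [| left; apply (not_lt_le Hw); auto].
    right. apply NNPP; intro H'. apply H. exists a. repeat split; auto.
    intros y Hy Hey HAya. apply H'. eauto.
Qed.

Lemma A_unbounded k : unbounded lt (A k).
Proof.
  intro b. destruct (uncountable_unbounded Hw Dl_uncountable b) as [xi [Hxi Hb]].
  destruct (p_admissible Hxi (admissible_exists k Hxi)) as [HD [Hlt Havoid]].
  exists (p k xi). split.
  - rewrite A_def. exists xi. repeat split; auto.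
  - left. destruct Hb as [Hb | ->]; [eapply lt_trans |]; eauto.
Qed.

Lemma A_meet_countable k y : ltK y k -> countable (fun a => A k a /\ A y a).
Proof.
  intro Hyk.
  apply countable_subset
    with (X := fun a => exists xi, le lt xi (e k y) /\ a = p k xi).
  - apply countable_image, countable_le; auto.
  - intros a [Hka Hya]. rewrite A_def in Hka.
    destruct Hka as [xi [_ [[_ [_ Havoid]] ->]]].
    exists xi. split; auto. apply (not_lt_le Hw). intro H. exact (Havoid y Hyk H Hya).
Qed.

End AlmostDisjoint.

Lemma almost_disjoint_family (O : Type) (lt : O -> O -> Prop)
  (K : Type) (ltK : K -> K -> Prop) :
  is_omega1 lt -> well_founded ltK -> (forall a b, ltK a b \/ a = b \/ ltK b a) ->
  (forall k, exists f : K -> O, forall x y, ltK x k -> ltK y k -> f x = f y -> x = y) ->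
  exists A : K -> O -> Prop,
    (forall k, unbounded lt (A k)) /\
    (forall k k', k <> k' -> countable (fun a => A k a /\ A k' a)).
Proof.
  intros Hw wfK trichK Hsmall.
  destruct (@choice K (K -> O)
     (fun k f => forall x y, ltK x k -> ltK y k -> f x = f y -> x = y) Hsmall)
    as [e e_inj].
  destruct (uncountable_disjoint_family Hw) as [Dl [D [HDl [HD Hdisj]]]].
  destruct (@well_founded_relational_recursion K (O -> Prop) ltK (fun _ => False)
     (ad_step lt Dl D ltK e) wfK) as [A HA].
  { intros k A. apply (ad_step_total Hw). }
  { apply ad_step_ext. }
  destruct (@choice K (O -> O) (fun k p =>
     (forall xi, Dl xi -> (exists a, admissible lt D ltK e k A xi a) ->
        admissible lt D ltK e k A xi (p xi)) /\
     A k = (fun a => exists xi, Dl xi /\ admissible lt D ltK e k A xi a /\ a = p xi)))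
    as [p Hp].
  { exact HA. }
  assert (p_admissible := fun k => proj1 (Hp k)).
  assert (A_def := fun k => proj2 (Hp k)).
  exists A. split.
  - intro k. apply (A_unbounded Hw HDl HD Hdisj e_inj p p_admissible A_def).
  - intros k k' Hne. destruct (trichK k k') as [H | [H | H]]; [| contradiction |].
    + apply countable_subset with (X := fun a => A k' a /\ A k a); [| tauto].
      exact (A_meet_countable Hw Dl p A_def _ _ H).
    + exact (A_meet_countable Hw Dl p A_def _ _ H).
Qed.

Section Stationary.
Variables (O : Type) (lt : O -> O -> Prop).
Hypothesis Hw : is_omega1 lt.

Lemma club_gt beta : club lt (lt beta).
Proof.
  split.
  - intros a [[b Hb] _] Hcl. destruct (Hcl b Hb) as [c [Hc [_ Hca]]].
    eapply lt_trans; eauto.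
  - apply (uncountable_unbounded Hw), (uncountable_gt Hw).
Qed.

Lemma countable_not_stationary (X : O -> Prop) : countable X -> ~ stationary lt X.
Proof.
  intros HX Hst. destruct (countable_bounded Hw HX) as [beta Hbeta].
  destruct (Hst _ (club_gt beta)) as [a [Ha HXa]].
  apply (lt_irrefl Hw a). eapply lt_trans; eauto.
Qed.

Definition guessed (T : O -> O -> Prop) (A : O -> Prop) (a : O) : Prop :=
  is_limit lt a /\ forall b, T a b -> A b.

Lemma guessed_meet_countable (T : O -> O -> Prop) (A B : O -> Prop) :
  (forall a, is_limit lt a -> cofinal_in lt (T a) a) ->
  countable (fun a => A a /\ B a) ->
  countable (fun a => guessed T A a /\ guessed T B a).
Proof.
  intros HT HAB. destruct (countable_bounded Hw HAB) as [beta Hbeta].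
  apply countable_subset with (X := fun a => le lt a beta); [apply countable_le; auto |].
  intros a [[Ha TA] [_ TB]]. apply (not_lt_le Hw); intro Hlt.
  destruct (proj2 (HT a Ha) beta Hlt) as [c [Tc Hc]].
  assert (lt c beta) by auto.
  destruct Hc as [Hc | ->]; apply (lt_irrefl Hw c); [eapply lt_trans |]; eauto.
Qed.

Lemma almost_disjoint_not_saturated (K : Type) (S : K -> O -> Prop) :
  (forall k, stationary lt (S k)) ->
  (forall k k', k <> k' -> countable (fun a => S k a /\ S k' a)) ->
  ~ NS_saturated K lt.
Proof.
  intros Hst Had Hsat. destruct (Hsat S Hst) as [k [k' [Hne Hmeet]]].
  exact (countable_not_stationary (Had k k' Hne) Hmeet).
Qed.

End Stationary.

Theorem mainTheorem8 (O : Type) (lt : O -> O -> Prop) (K : Type) (ltK : K -> K -> Prop) :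
  is_omega1 lt -> is_omega2_over O ltK ->
  clubsuit lt ->
  (exists S : K -> O -> Prop,
      (forall b, stationary lt (S b)) /\
      (forall b c, b <> c -> countable (fun a => S b a /\ S c a)))
  /\ ~ NS_saturated K lt.
Proof.
  intros Hw [[_ [_ [trichK wfK]]] [Hsmall _]] [T [Hcof Hguess]].
  destruct (almost_disjoint_family Hw wfK trichK Hsmall) as [A [Hunb Had]].
  set (S := fun k => guessed lt T (A k)).
  assert (HS : forall k, stationary lt (S k)) by (intro k; apply Hguess, Hunb).
  assert (HSad : forall k k', k <> k' -> countable (fun a => S k a /\ S k' a))
    by (intros k k' Hne; apply (guessed_meet_countable Hw), Had; auto).
  split.
  - exists S. auto.
  - exact (almost_disjoint_not_saturated Hw S HS HSad).
Qed.
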